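(* Let $S \in \{\mathbb{FT}, \overline{\mathbb{T}}\}$ and let $A, B \in M_n(S)$. The following are equivalent. (i) $A \leq_{\mathcal{J}} B$ in the semigroup $M_n(S)$; (ii) there exists a convex set $Y \subseteq S^n$ such that $R_S(A)$ embeds linearly into $Y$ and $R_S(B)$ surjects linearly onto $Y$; (iii) there exists a convex set $Y \subseteq S^n$ such that $R_S(A) \subseteq Y$ and $R_S(B)$ surjects linearly onto $Y$; (iv) there exists a convex set $Y \subseteq S^n$ such that $C_S(A)$ embeds linearly into $Y$ and $C_S(B)$ surjects linearly onto $Y$; (v) there exists a convex set $Y \subseteq S^n$ such that $C_S(A) \subseteq Y$ and $C_S(B)$ surjects linearly onto $Y$.
   Context: Semirings: $\mathbb{FT}$ (finitary tropical semiring) is the set $\mathbb{R}$ with $a \oplus b = \max(a,b)$ and $a \otimes b = ab = a+b$ (ordinary sum). $\mathbb{T} = \mathbb{FT} \cup \{-\infty\}$, where $-\infty$ is absorbing for $\otimes$ and is the identity for $\oplus$. $\overline{\mathbb{T}} = \mathbb{T} \cup \{+\infty\}$, where $+\infty$ is absorbing for both $\oplus$ and $\otimes$, except that $(-\infty)\otimes(+\infty) = (+\infty)\otimes(-\infty) = -\infty$. $M_n(S)$ is the semigroup of $n \times n$ matrices over $S$ under matrix multiplication induced from $\oplus$ and $\otimes$. $S^n$ is an $S$-module under componentwise $\oplus$ and scaling $(\lambda \otimes x)_i = \lambda \otimes x_i$. A convex set ($S$-linear convex set) in $S^n$ is a subset closed under $\oplus$ and under scaling by elements of $S$. The row space $R_S(A)$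 (respectively column space $C_S(A)$) is the set of all $S$-linear combinations of the rows (respectively columns) of $A$, regarded as a subset of $S^n$. A map $f: X \to Y$ between convex sets is linear if $f(x \oplus x') = f(x) \oplus f(x')$ and $f(\lambda \otimes x) = \lambda \otimes f(x)$ for all $x, x' \in X$, $\lambda \in S$. ''$X$ embeds linearly into $Y$'' means there is an injective linear map $X \to Y$; ''$X$ surjects linearly onto $Y$'' means there is a surjective linear map $X \to Y$. For a semigroup $M$, let $M^1 = M$ if $M$ is a monoid and otherwise $M^1$ is $M$ with an identity adjoined. Then $a \leq_{\mathcal{J}} b$ means $M^1 a M^1 \subseteq M^1 b M^1$. *)

(* Defs.v *)
From HB Require Import structures.
From mathcomp Require Import all_boot all_order all_algebra.
From mathcomp Require Import boolp classical_sets functions reals.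
From mathcomp Require Import constructive_ereal.
Set Implicit Arguments.
Unset Strict Implicit.
Unset Printing Implicit Defensive.
Import Order.TTheory GRing.Theory Num.Theory.
Local Open Scope classical_set_scope.
Local Open Scope ring_scope.

(* Neither a zero nor a unit is required: the finitary tropical semiring has
   no zero, so that MathComp's semirings and their matrix product do not
   apply. *)
Record semiring := Semiring {
  carrier :> Type;
  oplus : carrier -> carrier -> carrier;
  otimes : carrier -> carrier -> carrier;
  oplusA : associative oplus;
  oplusC : commutative oplus;
  otimesA : associative otimes;
  otimesC : commutative otimes;
  otimes_oplusl : left_distributive otimes oplus }.

Definition FT (R : realType) : semiring :=
  @Semiring R Num.max +%R maxA maxC (@addrA R) (@addrC R) (@addr_maxl R).

Lemma adde_maxl_distr (R : realType) :
  left_distributive (@adde R) Order.max.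
Proof.
move=> x y z; have homo : {homo (fun t => adde t z) : a b / (a <= b)%E}.
  by move=> a b ab; apply: leeD2r.
have [xy|/ltW yx] := leP x y.
  by rewrite (max_r (homo _ _ xy)).
by rewrite (max_l (homo _ _ yx)).
Qed.

(* MathComp-Analysis' addition on \bar R satisfies -oo + +oo = +oo + -oo = -oo,
   which is the convention required for the completed tropical semiring. *)
Definition Tbar (R : realType) : semiring :=
  @Semiring (\bar R) Order.max (@adde R) maxA maxC (@addeA R) (@addeC R)
    (@adde_maxl_distr R).

(* Sum of a nonempty family, which needs no neutral element: the last
   summand F ord0 plays the role of the initial value. *)
Definition sum1 (T : Type) (op : T -> T -> T) (n : nat) (F : 'I_n.+1 -> T) : T :=
  \big[op/F ord0]_(i < n) F (lift ord0 i).

Section Modules.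
Variable S : semiring.

Definition mxprod (m n p : nat) (A : 'M[S]_(m, n.+1)) (B : 'M[S]_(n.+1, p)) :
    'M[S]_(m, p) :=
  \matrix_(i, k) sum1 (@oplus S) (fun j => otimes (A i j) (B j k)).

(* The module S^n is 'rV[S]_n. *)
Definition vadd (n : nat) (x y : 'rV[S]_n) : 'rV[S]_n := map2_mx (@oplus S) x y.

Definition vscale (n : nat) (l : S) (x : 'rV[S]_n) : 'rV[S]_n :=
  map_mx (otimes l) x.

Definition convex (n : nat) (X : set 'rV[S]_n) : Prop :=
  (forall x y, X x -> X y -> X (vadd x y)) /\
  (forall l x, X x -> X (vscale l x)).

Definition row_space (m n : nat) (A : 'M[S]_(m.+1, n)) : set 'rV[S]_n :=
  range (fun c : 'I_m.+1 -> S =>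
    sum1 (@vadd n) (fun i => vscale (c i) (row i A))).

Definition col_space (m n : nat) (A : 'M[S]_(m, n.+1)) : set 'rV[S]_m :=
  range (fun c : 'I_n.+1 -> S =>
    sum1 (@vadd m) (fun j => vscale (c j) (col j A)^T)).

(* Only the values of f on X matter: a map X -> Y is represented by a map on
   the ambient module sending X into Y. *)
Definition linear_map (m n : nat) (X : set 'rV[S]_m) (Y : set 'rV[S]_n)
    (f : 'rV[S]_m -> 'rV[S]_n) : Prop :=
  [/\ set_fun X Y f,
      forall x x', X x -> X x' -> f (vadd x x') = vadd (f x) (f x')
    & forall l x, X x -> f (vscale l x) = vscale l (f x)].

Definition embeds (m n : nat) (X : set 'rV[S]_m) (Y : set 'rV[S]_n) : Prop :=
  exists2 f, linear_map X Y f & set_inj X f.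

Definition surjects (m n : nat) (X : set 'rV[S]_m) (Y : set 'rV[S]_n) : Prop :=
  exists2 f, linear_map X Y f & set_surj X Y f.

End Modules.

Section JOrder.
Variables (M : Type) (mul : M -> M -> M).

Definition is_monoid : Prop := exists e, left_id e mul /\ right_id e mul.

Definition adj_mul (u v : option M) : option M :=
  match u, v with
  | Some a, Some b => Some (mul a b)
  | None, w | w, None => w
  end.

(* M^1, inside M with an identity None adjoined. *)
Definition M1 : set (option M) :=
  [set u | is_monoid -> exists a, u = Some a].

Definition principal_ideal (a : M) : set (option M) :=
  [set adj_mul (adj_mul u (Some a)) v | u in M1 & v in M1].

Definition leJ (a b : M) : Prop := principal_ideal a `<=` principal_ideal b.

End JOrder.

(* Main.v *)
Require Import Defs.
From mathcomp Require Import all_boot all_order all_algebra.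
From mathcomp Require Import boolp classical_sets functions reals.
From mathcomp Require Import constructive_ereal.
Local Open Scope classical_set_scope.

(** In M_n(S), A is J-below B exactly when A = P B Q for some matrices P and Q.
    If so, right multiplication by Q maps the row space of B onto that of B Q,
    and the row space of A = P (B Q) lies inside the latter: this is the choice
    of Y in one direction.

    For the converse, let f embed the row space of A into Y and let g map the
    row space of B onto Y.  Let A' and C be the matrices whose rows are the
    images under f and g of the rows of A and B.  The rows of C generate Y, so
    A' = P C.  The rest is a duality principle ([mxprod_of_row_map]): if
    the assignment of row i of M to row i of N comes from a linear map
    between row spaces, then N = M Q for some Q.  Applied to g it gives
    C = B Q; applied to the inverse of f it gives A = A' Q'.  Hence
    A = P B (Q Q').

    The duality principle rests on residuation.  Fix a column of N.  The
    greatest q with M q below that column is given by finitely many residuals;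
    if M q missed the column at entry i, the residuals that bound q would
    provide a combination of the rows of M that dominates row i of M although
    the same combination of the rows of N does not dominate row i of N.  As
    the order is recovered from addition, no linear map does this.

    All that is used of S is that its addition is the maximum of a total
    order and that, when a residual is too small, some scalar witnesses it
    ([separated]); both tropical semirings have these properties.  The
    column statements follow by transposition, which reverses products of
    matrices and so preserves the J-order. *)

Set Implicit Arguments.
Unset Strict Implicit.
Unset Printing Implicit Defensive.
Import Order.TTheory GRing.Theory Num.Theory.

(** * Finite sums in a totally ordered semiring *)

Lemma sum1_ind2 (T T' : Type) (K : T -> T' -> Prop) (op : T -> T -> T)
    (op' : T' -> T' -> T') (n : nat) (F : 'I_n.+1 -> T) (G : 'I_n.+1 -> T') :
  (forall x x' y y', K x x' -> K y y' -> K (op x y) (op' x' y')) ->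
  (forall i, K (F i) (G i)) -> K (sum1 op F) (sum1 op' G).
Proof. by move=> Kop KFG; apply: big_ind2 => // *; apply: Kop. Qed.

Lemma sum1_ind (T : Type) (K : T -> Prop) (op : T -> T -> T) (n : nat)
    (F : 'I_n.+1 -> T) :
  (forall x y, K x -> K y -> K (op x y)) ->
  (forall i, K (F i)) -> K (sum1 op F).
Proof. by move=> Kop KF; apply: big_ind => // *; apply: Kop. Qed.

Lemma sum1_morph (T T' : Type) (f : T -> T') (op : T -> T -> T)
    (op' : T' -> T' -> T') (n : nat) (F : 'I_n.+1 -> T) :
  {morph f : x y / op x y >-> op' x y} ->
  f (sum1 op F) = sum1 op' (fun i => f (F i)).
Proof.
by move=> fM; apply: (sum1_ind2 (K := fun x y => f x = y)) => // *; rewrite fM; congr op'.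
Qed.

Lemma eq_sum1 (T : Type) (op : T -> T -> T) (n : nat) (F G : 'I_n.+1 -> T) :
  F =1 G -> sum1 op F = sum1 op G.
Proof. by move=> /funext ->. Qed.

Definition sle (S : semiring) (x y : S) : Prop := oplus x y = y.

(** The second field says that q is a residual of c by b in a strong sense:
    whenever q is too small to bring b0 up to c0, some scalar l witnesses it,
    scaling b above b0 while keeping c below c0.  In the finitary tropical
    semiring, q = c - b and l = b0 - b; with infinite scalars, where
    subtraction is not available, the same property still holds. *)
Record separated (S : semiring) : Prop := Separated {
  oplus_sel : forall x y : S, oplus x y = x \/ oplus x y = y;
  residual_sep : forall b c : S, exists2 q,
    sle (otimes b q) c &
    forall b0 c0, sle c0 (otimes b0 q) \/
      exists2 l, sle b0 (otimes l b) & ~ sle c0 (otimes l c) }.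

Section Theory.
Variables (S : semiring) (sepS : separated S).
Local Open Scope ring_scope.

Lemma sle_refl (x : S) : sle x x.
Proof. by case: (oplus_sel sepS x x). Qed.

Lemma sle_trans (y x z : S) : sle x y -> sle y z -> sle x z.
Proof. by rewrite /sle => xy yz; rewrite -yz oplusA xy. Qed.

Lemma sle_anti (x y : S) : sle x y -> sle y x -> x = y.
Proof. by rewrite /sle => xy <-; rewrite oplusC. Qed.

Lemma sle_total (x y : S) : sle x y \/ sle y x.
Proof. by rewrite /sle [oplus y x]oplusC; case: (oplus_sel sepS x y); auto. Qed.

Lemma sle_oplusl (x y : S) : sle x (oplus x y).
Proof. by rewrite /sle oplusA sle_refl. Qed.

Lemma sle_oplusr (x y : S) : sle y (oplus x y).
Proof. by rewrite oplusC; apply: sle_oplusl. Qed.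

Lemma oplus_lub (x y z : S) : sle x z -> sle y z -> sle (oplus x y) z.
Proof. by rewrite /sle => xz yz; rewrite -oplusA yz. Qed.

Lemma otimes_oplusr (x : S) : {morph (otimes x) : y z / oplus y z}.
Proof. by move=> y z; rewrite !(otimesC x) otimes_oplusl. Qed.

Lemma sle_otimes2l (x y z : S) : sle y z -> sle (otimes x y) (otimes x z).
Proof. by rewrite /sle -otimes_oplusr => ->. Qed.

Lemma sum1_lub (n : nat) (F : 'I_n.+1 -> S) z :
  (forall i, sle (F i) z) -> sle (sum1 (@oplus S) F) z.
Proof.
by move=> Fz; apply: (sum1_ind (K := fun x => sle x z) _ Fz) => x y; apply: oplus_lub.
Qed.

Lemma sle_sum1 (n : nat) (F : 'I_n.+1 -> S) i : sle (F i) (sum1 (@oplus S) F).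
Proof.
have ub (r : seq 'I_n) (x : S) (G : 'I_n -> S) :
    let s := \big[@oplus S/x]_(j <- r) G j in
    sle x s /\ forall j, j \in r -> sle (G j) s.
  (* The summand F ord0 is the initial value of the fold, hence the two parts. *)
  elim: r => [|k r [IHx IHr]] /=; first by rewrite big_nil; split=> //; apply: sle_refl.
  rewrite big_cons; split; first exact: sle_trans IHx (sle_oplusr _ _).
  move=> j; rewrite inE => /orP[/eqP->|/IHr Gj]; first exact: sle_oplusl.
  exact: sle_trans Gj (sle_oplusr _ _).
have [ub0 ubl] := ub (index_enum 'I_n) (F ord0) (fun j => F (lift ord0 j)).
by case: (unliftP ord0 i) => [j|] ->; [apply: ubl; rewrite mem_index_enum | apply: ub0].
Qed.

Lemma sum1_attained (n : nat) (F : 'I_n.+1 -> S) : exists i, sum1 (@oplus S) F = F i.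
Proof.
apply: (sum1_ind (K := fun x => exists i, x = F i)) => [x y|i]; last by exists i.
by move=> Fx Fy; case: (oplus_sel sepS x y) => ->.
Qed.

Lemma sum1_oplus (n : nat) (F G : 'I_n.+1 -> S) :
  sum1 (@oplus S) (fun i => oplus (F i) (G i)) =
  oplus (sum1 (@oplus S) F) (sum1 (@oplus S) G).
Proof.
apply: sle_anti.
  apply: sum1_lub => i; apply: oplus_lub.
    exact: sle_trans (sle_sum1 F i) (sle_oplusl _ _).
  exact: sle_trans (sle_sum1 G i) (sle_oplusr _ _).
apply: oplus_lub; apply: sum1_lub => i;
  apply: sle_trans (sle_sum1 (fun i => oplus (F i) (G i)) i).
  exact: sle_oplusl.
exact: sle_oplusr.
Qed.

(** Each double sum is the supremum of all the F i j. *)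
Lemma exchange_sum1 (m n : nat) (F : 'I_m.+1 -> 'I_n.+1 -> S) :
  sum1 (@oplus S) (fun i => sum1 (@oplus S) (F i)) =
  sum1 (@oplus S) (fun j => sum1 (@oplus S) (F^~ j)).
Proof.
have half p q (G : 'I_p.+1 -> 'I_q.+1 -> S) :
    sle (sum1 (@oplus S) (fun i => sum1 (@oplus S) (G i)))
        (sum1 (@oplus S) (fun j => sum1 (@oplus S) (G^~ j))).
  apply: sum1_lub => i; apply: sum1_lub => j.
  apply: sle_trans (sle_sum1 (fun j => sum1 (@oplus S) (G^~ j)) j).
  exact: sle_sum1 (G^~ j) i.
by apply: sle_anti; [apply: half | apply: (half _ _ (fun j i => F i j))].
Qed.

Lemma sle_min (n : nat) (F : 'I_n.+1 -> S) : exists i0, forall i, sle (F i0) (F i).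
Proof.
elim: n F => [|n IH] F.
  by exists ord0 => i; rewrite (ord1 i); apply: sle_refl.
have [i0 min0] := IH (fun i => F (lift ord0 i)).
have [le0|le0] := sle_total (F ord0) (F (lift ord0 i0)).
  exists ord0 => i; case: (unliftP ord0 i) => [j|] ->; last exact: sle_refl.
  exact: sle_trans le0 (min0 j).
by exists (lift ord0 i0) => i; case: (unliftP ord0 i) => [j|] ->.
Qed.

(** * Matrix products and row spaces *)

(** No neutral element is at hand for the inner sums, so associativity goes
    through the exchange of two nonempty sums. *)
Lemma mxprodA (m n p q : nat) (A : 'M[S]_(m, n.+1)) (B : 'M[S]_(n.+1, p.+1))
    (C : 'M[S]_(p.+1, q)) :
  mxprod A (mxprod B C) = mxprod (mxprod A B) C.
Proof.
apply/matrixP => i l; rewrite !mxE.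
under eq_sum1 => j do rewrite mxE (sum1_morph _ (otimes_oplusr (A i j))).
rewrite exchange_sum1; apply: eq_sum1 => k; rewrite mxE.
rewrite (sum1_morph (f := (@otimes S)^~ (C k l)) _ (fun x y => otimes_oplusl x y _)).
by apply: eq_sum1 => j; rewrite otimesA.
Qed.

Lemma trmx_prod (m n p : nat) (A : 'M[S]_(m, n.+1)) (B : 'M[S]_(n.+1, p)) :
  (mxprod A B)^T = mxprod B^T A^T.
Proof.
by apply/matrixP => i k; rewrite !mxE; apply: eq_sum1 => j; rewrite !mxE otimesC.
Qed.

Lemma mxprod_vaddl (n p : nat) (x y : 'rV[S]_n.+1) (A : 'M[S]_(n.+1, p)) :
  mxprod (vadd x y) A = vadd (mxprod x A) (mxprod y A).
Proof.
apply/matrixP => i k; rewrite !mxE -sum1_oplus; apply: eq_sum1 => j.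
by rewrite mxE otimes_oplusl.
Qed.

Lemma mxprod_vscalel (n p : nat) l (x : 'rV[S]_n.+1) (A : 'M[S]_(n.+1, p)) :
  mxprod (vscale l x) A = vscale l (mxprod x A).
Proof.
apply/matrixP => i k; rewrite !mxE (sum1_morph _ (otimes_oplusr l)).
by apply: eq_sum1 => j; rewrite mxE otimesA.
Qed.

Lemma lincombE (m n : nat) (c : 'I_m.+1 -> S) (r : 'I_m.+1 -> 'rV[S]_n) i k :
  (sum1 (@vadd S n) (fun j => vscale (c j) (r j))) i k =
  sum1 (@oplus S) (fun j => otimes (c j) (r j i k)).
Proof.
rewrite (sum1_morph (f := fun x : 'rV[S]_n => x i k) (op' := @oplus S)).
  by apply: eq_sum1 => j; rewrite mxE.
by move=> x y; rewrite mxE.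
Qed.

Lemma row_spaceP (m n : nat) (A : 'M[S]_(m.+1, n)) (x : 'rV[S]_n) :
  row_space A x <-> exists c : 'rV[S]_m.+1, x = mxprod c A.
Proof.
have lincomb c : sum1 (@vadd S n) (fun i => vscale (c i) (row i A)) =
    mxprod (\row_i c i) A.
  apply/rowP => k; rewrite lincombE mxE.
  by apply: eq_sum1 => j; rewrite !mxE.
split=> [[c _ <-]|[c ->]]; first by exists (\row_i c i); rewrite lincomb.
exists (c ord0) => //; rewrite lincomb; congr mxprod.
by apply/rowP => k; rewrite mxE.
Qed.

Lemma row_space_convex (m n : nat) (A : 'M[S]_(m.+1, n)) : convex (row_space A).
Proof.
split=> [_ _ /row_spaceP[c ->] /row_spaceP[d ->]|l _ /row_spaceP[c ->]];
  apply/row_spaceP.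
- by exists (vadd c d); rewrite mxprod_vaddl.
- by exists (vscale l c); rewrite mxprod_vscalel.
Qed.

Lemma row_space_mxprod (m n p : nat) (P : 'M[S]_(m.+1, n.+1))
    (B : 'M[S]_(n.+1, p)) : row_space (mxprod P B) `<=` row_space B.
Proof.
move=> _ /row_spaceP[c ->]; apply/row_spaceP.
by exists (mxprod c P); rewrite mxprodA.
Qed.

Lemma row_space_surjects (m n p : nat) (B : 'M[S]_(m.+1, n.+1))
    (Q : 'M[S]_(n.+1, p)) : surjects (row_space B) (row_space (mxprod B Q)).
Proof.
exists (fun x => mxprod x Q).
  split=> [_ /row_spaceP[c ->]|x x' _ _|l x _].
  - by apply/row_spaceP; exists c; rewrite mxprodA.
  - exact: mxprod_vaddl.
  - exact: mxprod_vscalel.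
move=> _ /row_spaceP[c ->]; exists (mxprod c B); last by rewrite mxprodA.
by apply/row_spaceP; exists c.
Qed.

Lemma col_space_tr (m n : nat) (A : 'M[S]_(m, n.+1)) : col_space A = row_space A^T.
Proof.
congr (image setT _); apply/funext => c.
by apply: eq_sum1 => j; rewrite tr_col.
Qed.

(** * Linear maps on row spaces and right multiplication *)

(** The duality principle.  The hypothesis is the part of linearity of a map
    sending row i of B to row i of C that the argument needs: an inequality
    between a row and a combination of n.+1 rows of B passes to C.  Stating
    it so, instead of with a map on the row space of B, avoids requiring that
    the rows of B belong to that space, which is itself deduced from this lemma
    (see [row_space_row]), and lets the inverse of an injection be used without
    being constructed. *)
Lemma mxprod_of_row_map (m n p : nat) (B : 'M[S]_(m.+1, n.+1)) (C : 'M[S]_(m.+1, p)) :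
  (forall i (s : 'I_n.+1 -> 'I_m.+1) (l : 'I_n.+1 -> S),
     let comb k (M : 'M[S]_(m.+1, k)) :=
       sum1 (@vadd S k) (fun j => vscale (l j) (row (s j) M)) in
     vadd (row i B) (comb _ B) = comb _ B ->
     vadd (row i C) (comb _ C) = comb _ C) ->
  exists Q, C = mxprod B Q.
Proof.
move=> BC.
suff col k : exists q : 'I_n.+1 -> S,
    forall i, C i k = sum1 (@oplus S) (fun j => otimes (B i j) (q j)).
  have [q qE] := choice col; exists (\matrix_(j, k) q k j).
  by apply/matrixP => i k; rewrite mxE qE; apply: eq_sum1 => j; rewrite mxE.
(* The j-th coordinate of the solution is the least of the residuals of
   C i k by B i j; the row at which it is attained is kept, as it yields the
   witness of the failure below. *)
have qmin j : exists qs : S * 'I_m.+1,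
    (forall i, sle (otimes (B i j) qs.1) (C i k)) /\
    (forall b0 c0, sle c0 (otimes b0 qs.1) \/ exists2 l,
       sle b0 (otimes l (B qs.2 j)) & ~ sle c0 (otimes l (C qs.2 k))).
  have /choice[q qP] i : exists q, sle (otimes (B i j) q) (C i k) /\
      forall b0 c0, sle c0 (otimes b0 q) \/
        exists2 l, sle b0 (otimes l (B i j)) & ~ sle c0 (otimes l (C i k)).
    by have [q ? ?] := residual_sep sepS (B i j) (C i k); exists q.
  have [i0 min0] := sle_min q; exists (q i0, i0) => /=.
  split=> [i|]; last exact: (qP i0).2.
  exact: sle_trans (sle_otimes2l _ (min0 i)) (qP i).1.
have {qmin} [qs qsP] := choice qmin.
exists (fun j => (qs j).1) => i; apply: sle_anti; last first.
  by apply: sum1_lub => j; apply: (qsP j).1.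
apply: contrapT => nle.
(* If entry i falls short, then each summand does, and each column j provides
   a scalar l j; row i of B is then below the combination x. *)
have /choice[l lP] j : exists l, sle (B i j) (otimes l (B (qs j).2 j)) /\
    ~ sle (C i k) (otimes l (C (qs j).2 k)).
  have [le|[l ? ?]] := (qsP j).2 (B i j) (C i k); last by exists l.
  case: nle; apply: sle_trans le _.
  exact: (sle_sum1 (fun j => otimes (B i j) (qs j).1)).
pose x := sum1 (@vadd S n.+1) (fun j => vscale (l j) (row (qs j).2 B)).
have Bi : vadd (row i B) x = x.
  apply/rowP => j; rewrite mxE lincombE mxE; apply: (sle_trans (lP j).1).
  have := sle_sum1 (fun j' => otimes (l j') (row (qs j').2 B ord0 j)) j.
  by rewrite /= [row _ _ _ _]mxE.
have /rowP/(_ k) := BC i (fun j => (qs j).2) l Bi.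
rewrite mxE lincombE mxE.
(* Being a maximum, the combination of the entries of C is one of its terms,
   none of which reaches C i k. *)
have [j ->] := sum1_attained (fun j => otimes (l j) (row (qs j).2 C ord0 k)).
by rewrite mxE => /(lP j).2.
Qed.

(** A substitute for the identity matrix, which the finitary tropical semiring
    lacks in sizes above 1: each matrix has its own right identity, by the duality
    principle for the identity map. *)
Lemma mxprod_rself (m n : nat) (A : 'M[S]_(m.+1, n.+1)) : exists Q, A = mxprod A Q.
Proof. exact: mxprod_of_row_map. Qed.

Lemma mxprod_lself (m n : nat) (A : 'M[S]_(m.+1, n.+1)) : exists P, A = mxprod P A.
Proof.
have [Q /(congr1 trmx)] := mxprod_rself A^T.
by rewrite trmx_prod !trmxK => AE; exists Q^T.
Qed.

(** Selecting a row is not a combination with zero coefficients, for want of a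
    zero; a left identity of A provides the coefficients instead. *)
Lemma row_space_row (m n : nat) (A : 'M[S]_(m.+1, n.+1)) i : row_space A (row i A).
Proof.
have [P AE] := mxprod_lself A; apply/row_spaceP; exists (row i P).
apply/rowP => k; rewrite {1}AE !mxE.
by apply: eq_sum1 => j; rewrite mxE.
Qed.

Lemma linear_comb (m n p : nat) (X : set 'rV[S]_m) (Y : set 'rV[S]_n) f
    (c : 'I_p.+1 -> S) (r : 'I_p.+1 -> 'rV[S]_m) :
  convex X -> linear_map X Y f -> (forall j, X (r j)) ->
  let s := sum1 (@vadd S m) (fun j => vscale (c j) (r j)) in
  X s /\ f s = sum1 (@vadd S n) (fun j => vscale (c j) (f (r j))).
Proof.
move=> [Xadd Xscale] [_ fadd fscale] Xr /=.
apply: (sum1_ind2 (K := fun x y => X x /\ f x = y)).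
  by move=> x _ y _ [Xx <-] [Xy <-]; split; [apply: Xadd | apply: fadd].
by move=> j; split; [apply: Xscale | apply: fscale].
Qed.

(** The adjoined identity does not contribute new factorisations, because it
    can be replaced by a left or right identity of the matrix B. *)
Lemma leJ_mxprod (n : nat) (A B : 'M[S]_n.+1) :
  leJ (@mxprod S n.+1 n n.+1) A B <-> exists P Q, A = mxprod P (mxprod B Q).
Proof.
split=> [AB|[P [Q AE]] w [u Mu [v Mv <-]]].
  have [E EA] := mxprod_lself A; have [E' AE'] := mxprod_rself A.
  have M1Some (M : 'M[S]_n.+1) : M1 (@mxprod S n.+1 n n.+1) (Some M).
    by move=> _; exists M.
  have [|u _ [v _]] := AB (Some A).
    by exists (Some E) => //; exists (Some E') => //=; rewrite -EA -AE'.
  have [D DB] := mxprod_lself B; have [D' BD'] := mxprod_rself B.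
  case: u v => [P|] [Q|] //= [AE]; [exists P, Q|exists P, D'|exists D, Q|exists D, D'];
    by rewrite -AE mxprodA -?DB // -mxprodA -BD'.
exists (Some (if u is Some U then mxprod U P else P)).
  by move=> _; eexists.
exists (Some (if v is Some V then mxprod Q V else Q)).
  by move=> _; eexists.
by rewrite AE; case: u v {Mu Mv} => [U|] [V|] /=; rewrite !mxprodA.
Qed.

Lemma row_space_leJ (n : nat) (A B : 'M[S]_n.+1) (Y : set 'rV[S]_n.+1) :
  embeds (row_space A) Y -> surjects (row_space B) Y ->
  leJ (@mxprod S n.+1 n n.+1) A B.
Proof.
move=> [f flin finj] [g glin gsurj]; apply/leJ_mxprod.
have rowE (h : 'rV[S]_n.+1 -> 'rV[S]_n.+1) (M : 'M[S]_n.+1) i :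
    row i (\matrix_j h (row j M)) = h (row i M) by rewrite rowK.
pose C := \matrix_i g (row i B).
pose A' := \matrix_i f (row i A).
have [Q CE] : exists Q, C = mxprod B Q.
  apply: mxprod_of_row_map => i s l /= Bi.
  have [Bs gs] := linear_comb l (row_space_convex B) glin
    (fun j => row_space_row B (s j)).
  under eq_sum1 => j do rewrite rowE.
  have [_ gadd _] := glin.
  by rewrite rowE -gs -gadd ?Bi //; apply: row_space_row.
(* Injectivity of f reflects the inequalities between the rows of A'. *)
have [Q' AE] : exists Q', A = mxprod A' Q'.
  apply: mxprod_of_row_map => i s l /=.
  have [As fs] := linear_comb l (row_space_convex A) flin
    (fun j => row_space_row A (s j)).
  under eq_sum1 => j do rewrite rowE.
  have [_ fadd _] := flin; have [Aadd _] := row_space_convex A.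
  have Ai := row_space_row A i.
  by rewrite rowE -fs -fadd // => fE; apply: finj => //; apply/mem_set => //; apply: Aadd.
have [P A'E] : exists P, A' = mxprod P C.
  have /choice[c cE] i : exists c : 'rV[S]_n.+1, f (row i A) = mxprod c C.
    have [fY _ _] := flin.
    have [x [c _ <-] <-] := gsurj _ (fY _ (row_space_row A i)).
    have [_ ->] := linear_comb c (row_space_convex B) glin (row_space_row B).
    apply/row_spaceP; exists c => //.
    by apply: eq_sum1 => j; rewrite rowE.
  exists (\matrix_i c i); apply/row_matrixP => i; rewrite rowE cE.
  by apply/rowP => k; rewrite !mxE; apply: eq_sum1 => j; rewrite mxE.
by exists P, (mxprod Q Q'); rewrite {1}AE A'E CE !mxprodA.
Qed.

Lemma leJ_row_space (n : nat) (A B : 'M[S]_n.+1) :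
  leJ (@mxprod S n.+1 n n.+1) A B ->
  exists Y : set 'rV[S]_n.+1,
    [/\ convex Y, row_space A `<=` Y & surjects (row_space B) Y].
Proof.
move=> /leJ_mxprod[P [Q ->]]; exists (row_space (mxprod B Q)); split.
- exact: row_space_convex.
- exact: row_space_mxprod.
- exact: row_space_surjects.
Qed.

Lemma leJ_tr (n : nat) (A B : 'M[S]_n.+1) :
  leJ (@mxprod S n.+1 n n.+1) A B -> leJ (@mxprod S n.+1 n n.+1) A^T B^T.
Proof.
move=> /leJ_mxprod[P [Q ->]]; apply/leJ_mxprod; exists Q^T, P^T.
by rewrite !trmx_prod mxprodA.
Qed.

Lemma subset_embeds (n : nat) (X Y : set 'rV[S]_n) : X `<=` Y -> embeds X Y.
Proof. by move=> XY; exists id. Qed.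

End Theory.

(** * The two tropical semirings *)

Section Instances.
Variable R : realType.
Local Open Scope ring_scope.

Lemma FT_sle (x y : FT R) : sle x y <-> (x : R) <= y.
Proof. by split=> /max_idPr. Qed.

Lemma FT_separated : separated (FT R).
Proof.
split=> [x y|b c].
  by rewrite /= /Num.max; case: ifP; auto.
exists (c - b : R); first by apply/FT_sle => /=; rewrite addrC subrK.
move=> b0 c0; have [le|lt] := leP (c0 : R) (b0 + (c - b)).
  by left; apply/FT_sle.
right; exists (b0 - b : R); first by apply/FT_sle; rewrite /= subrK.
by move=> /FT_sle /=; apply/negP; rewrite -ltNge -addrA [- _ + _]addrC.
Qed.

Lemma Tbar_sle (x y : Tbar R) : sle x y <-> ((x : \bar R) <= y)%E.
Proof. by split=> /max_idPr. Qed.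

Lemma Tbar_separated : separated (Tbar R).
Proof.
split=> [x y|b c].
  by rewrite /= /Order.max; case: ifP; auto.
(* When c0 is -oo every q reaches it, and when b0 is -oo the scalar -oo is a
   witness; so both may be assumed different from -oo. *)
suff [q bqc sep] : exists2 q : \bar R, (b + q <= c)%E &
    forall b0 c0 : \bar R, b0 != -oo%E -> c0 != -oo%E -> (c0 <= b0 + q)%E \/
      exists2 l : \bar R, (b0 <= l + b)%E & (l + c < c0)%E.
  exists q; first exact/Tbar_sle.
  move=> b0 c0; have [->|c0N] := eqVneq (c0 : \bar R) -oo%E.
    by left; apply/Tbar_sle; rewrite leNye.
  have [->|b0N] := eqVneq (b0 : \bar R) -oo%E.
    right; exists -oo%E; apply/Tbar_sle; first by rewrite leNye.
    by rewrite [otimes _ _](addNye c) leeNy_eq (negPf c0N).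
  have [le|[l le lt]] := sep b0 c0 b0N c0N; first by left; apply/Tbar_sle.
  by right; exists l; [apply/Tbar_sle | move=> /Tbar_sle; rewrite leNgt [X in ~~ X]lt].
(* In each case below q is the greatest element with b + q <= c. *)
have addy (x : \bar R) : x != -oo%E -> (x + +oo = +oo)%E by move=> ?; apply: addey.
case: b => [b| |]; last 1 first.
- exists +oo%E; first by rewrite addNye leNye.
  by move=> b0 c0 b0N _; left; rewrite addy // leey.
- case: c => [c| |].
  + exists (c - b)%:E; first by rewrite lee_fin addrC subrK.
    move=> [b0| |] [c0| |] // _ _.
    * have [le|lt] := leP c0 (b0 + (c - b)); first by left; rewrite lee_fin.
      right; exists (b0 - b)%:E; first by rewrite lee_fin subrK.
      by rewrite lte_fin -addrA [- _ + _]addrC.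
    * by right; exists (b0 - b)%:E; [rewrite lee_fin subrK | rewrite ltry].
    * by left; rewrite leey.
    * by left.
  + exists +oo%E; first by rewrite leey.
    by move=> b0 c0 b0N _; left; rewrite addy // leey.
  (* The scalar +oo lifts the finite b above b0 and leaves c = -oo fixed. *)
  + exists -oo%E; first by rewrite addeNy leNye.
    move=> b0 c0 _ c0N; right; exists +oo%E; first by rewrite leey.
    by rewrite addeNy ltNye.
- case: c => [c| |].
  + exists -oo%E; first by rewrite addeNy leNye.
    move=> b0 [c0| |] // _ _; right.
      (* Since b = +oo, any finite scalar lifts b above b0. *)
      exists (c0 - c - 1)%:E; first by rewrite leey.
      by rewrite lte_fin addrAC subrK gtrBl.
    by exists 0%E; [rewrite leey | rewrite ltry].
  + exists +oo%E; first by rewrite leey.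
    by move=> b0 c0 b0N _; left; rewrite addy // leey.
  + exists -oo%E; first by rewrite addeNy leNye.
    move=> b0 c0 _ c0N; right; exists 0%E; first by rewrite leey.
    by rewrite addeNy ltNye.
Qed.

End Instances.

Theorem theorem5p3 (R : realType) (S : semiring) (hS : S = FT R \/ S = Tbar R)
    (n : nat) (A B : 'M[S]_n.+1) :
  [<-> leJ (@mxprod S n.+1 n n.+1) A B;
       exists Y : set 'rV[S]_n.+1,
         [/\ convex Y, embeds (row_space A) Y & surjects (row_space B) Y];
       exists Y : set 'rV[S]_n.+1,
         [/\ convex Y, row_space A `<=` Y & surjects (row_space B) Y];
       exists Y : set 'rV[S]_n.+1,
         [/\ convex Y, embeds (col_space A) Y & surjects (col_space B) Y];
       exists Y : set 'rV[S]_n.+1,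
         [/\ convex Y, col_space A `<=` Y & surjects (col_space B) Y]].
Proof.
have sepS : separated S.
  by case: hS => ->; [apply: FT_separated | apply: Tbar_separated].
rewrite !col_space_tr; tfae.
- move=> /(leJ_row_space sepS)[Y [cY AY BY]].
  by exists Y; split=> //; apply: subset_embeds.
- by move=> [Y [_ AY BY]]; apply: leJ_row_space => //; apply: row_space_leJ AY BY.
- move=> [Y [_ /subset_embeds AY BY]].
  have /(leJ_tr sepS)/(leJ_row_space sepS) := row_space_leJ sepS AY BY.
  by move=> [Z [cZ AZ BZ]]; exists Z; split=> //; apply: subset_embeds.
- by move=> [Y [_ AY BY]]; apply: leJ_row_space => //; apply: row_space_leJ AY BY.
- move=> [Y [_ /subset_embeds AY BY]].
  have /(leJ_tr sepS) := row_space_leJ sepS AY BY.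
  by rewrite !trmxK.
Qed.
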